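(* Suppose that for every étale extension of polynomial rings $A=\mathbb{C}[p,q]\subset B=\mathbb{C}[x,y]$ with $\overline{A}\neq B$, the integral closure $\overline{A}$ of $A$ in $B$ is a primary $\overline{A}$-submodule of $B$. Then every étale extension of polynomial rings $\mathbb{C}[p,q]\subset\mathbb{C}[x,y]$ is integral.
   Context: An étale extension $A\subset B$ means that the inclusion ring homomorphism is étale; $\mathbb{C}[p,q]$ is a polynomial ring in two indeterminates, i.e. $p,q\in\mathbb{C}[x,y]$ are algebraically independent over $\mathbb{C}$. A submodule $N$ of a module $M$ over a ring $R$ is called primary if $M/N$ has exactly one associated prime, i.e. $\mathrm{Ass}_{R}(M/N)$ consists of a single element. *)

(* Defs.v *)
From HB Require Import structures.
From mathcomp Require Import all_boot all_order all_algebra.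
From mathcomp Require Import boolp classical_sets reals.
From mathcomp Require Import complex mpoly.

Set Implicit Arguments.
Unset Strict Implicit.
Unset Printing Implicit Defensive.

Import GRing.Theory.
Local Open Scope ring_scope.
Local Open Scope classical_set_scope.

Definition finitely_presented (A B : comNzRingType) (f : {rmorphism A -> B}) :
    Prop :=
  exists (n : nat) (phi : {rmorphism {mpoly A[n]} -> B}),
    [/\ forall a : A, phi a%:MP = f a,
        forall b : B, exists u, phi u = b &
        exists (m : nat) (r : 'I_m -> {mpoly A[n]}), forall u,
          phi u = 0 <-> exists c : 'I_m -> {mpoly A[n]},
                          u = \sum_(i < m) c i * r i].

(* The surjections [pi] with square-zero kernel are the projections
   [C -> C / I] with [I ^ 2 = 0], up to isomorphism; the zero ring is allowed. *)
Definition formally_etale (A B : comNzRingType) (f : {rmorphism A -> B}) :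
    Prop :=
  forall (C D : comPzRingType) (pi : {rmorphism C -> D}),
    (forall d : D, exists c, pi c = d) ->
    (forall c c' : C, pi c = 0 -> pi c' = 0 -> c * c' = 0) ->
  forall (g : {rmorphism A -> C}) (h : {rmorphism B -> D}),
    (forall a, h (f a) = pi (g a)) ->
  exists k : {rmorphism B -> C},
    [/\ forall a, k (f a) = g a, forall b, pi (k b) = h b &
        forall k' : {rmorphism B -> C},
          (forall a, k' (f a) = g a) -> (forall b, pi (k' b) = h b) ->
          k' =1 k].

Definition etale (A B : comNzRingType) (f : {rmorphism A -> B}) : Prop :=
  finitely_presented f /\ formally_etale f.

Definition prime_ideal (R : comNzRingType) (P : set R) : Prop :=
  idealr_closed (mem P) /\ prime_idealr_closed (mem P).

(* [Ass_R (M / N)]: the prime ideals which are the annihilator of the class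
   modulo [N] of some [m : M]. *)
Definition Ass_quotient (R : comNzRingType) (M : lmodType R)
    (N : submodClosed M) : set (set R) :=
  [set P | prime_ideal P /\ exists m : M, P = [set r | r *: m \in N]].

Definition primary_submodule (R : comNzRingType) (M : lmodType R)
    (N : submodClosed M) : Prop :=
  exists P : set R, Ass_quotient N = [set P].

(* A copy of [B] on which the subring [S] acts: [B] itself may already be a
   module over another ring. *)
Definition over_subring (B : comNzRingType) (S : subringClosed B) : Type := B.

Section Subrings.
Variables (B : comNzRingType) (S : subringClosed B).

Definition subring : Type := {b : B | b \in S}.

HB.instance Definition _ := SubChoice.on subring.
HB.instance Definition _ := [SubChoice_isSubComNzRing of subring by <:].

Definition incl : {rmorphism subring -> B} := \val.

HB.instance Definition _ := GRing.Zmodule.copy (over_subring S) B.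

Definition over_subring_scale (r : subring) (b : over_subring S) :
    over_subring S :=
  incl r * (b : B).

Fact over_subring_scaleA r s b :
  over_subring_scale r (over_subring_scale s b) = over_subring_scale (r * s) b.
Proof. by rewrite /over_subring_scale rmorphM mulrA. Qed.

Fact over_subring_scale1 : left_id 1 over_subring_scale.
Proof. by move=> b; rewrite /over_subring_scale rmorph1 mul1r. Qed.

Fact over_subring_scaleDr : right_distributive over_subring_scale +%R.
Proof. by move=> r b c; apply: mulrDr. Qed.

Fact over_subring_scaleDl b : {morph over_subring_scale^~ b : r s / r + s}.
Proof. by move=> r s; rewrite /over_subring_scale rmorphD mulrDl. Qed.

HB.instance Definition _ := GRing.Zmodule_isLmodule.Build subring
  (over_subring S) over_subring_scaleA over_subring_scale1
  over_subring_scaleDr over_subring_scaleDl.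

Definition subring_as_submod : {pred over_subring S} := [pred b : B | b \in S].

Fact subring_submod_closed : submod_closed subring_as_submod.
Proof.
split=> [|r b c bS cS]; first exact: rpred0.
by apply: rpredD => //; apply: rpredM => //; apply: (valP r).
Qed.

HB.instance Definition _ := GRing.isSubmodClosed.Build subring
  (over_subring S) subring_as_submod subring_submod_closed.

End Subrings.

Arguments subring_as_submod {B} S _.

Section IntegralClosure.
Variables (B : comNzRingType) (S : subringClosed B).

Definition integral_closure : {pred B} :=
  [pred b | `[< integralOver (incl S) b >]].

Fact integral_closure_subring : subring_closed integral_closure.
Proof.
split=> [|b c /asboolP bI /asboolP cI|b c /asboolP bI /asboolP cI];
  apply/asboolP.
- exact: integral1.
- exact: integral_sub.
- exact: integral_mul.
Qed.

HB.instance Definition _ := GRing.isSubringClosed.Build B integral_closure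
  integral_closure_subring.

End IntegralClosure.

Section PolynomialSubring.
Variables (K : comNzRingType) (p q : {mpoly K[2]}).

(* [K[p, q]] as a subring of [K[x, y]], where [x] is ['X_0] and [y] is ['X_1] *)
Definition poly_subring : {pred {mpoly K[2]}} :=
  [pred b | `[< exists u : {mpoly K[2]}, b = u \mPo [tuple p; q] >]].

Fact poly_subring_closed : subring_closed poly_subring.
Proof.
split=> [|_ _ /asboolP[u ->] /asboolP[v ->]|_ _ /asboolP[u ->] /asboolP[v ->]];
  apply/asboolP.
- by exists 1; rewrite rmorph1.
- by exists (u - v); rewrite rmorphB.
- by exists (u * v); rewrite rmorphM.
Qed.

HB.instance Definition _ := GRing.isSubringClosed.Build {mpoly K[2]}
  poly_subring poly_subring_closed.

Definition algebraically_independent : Prop :=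
  forall u : {mpoly K[2]}, u \mPo [tuple p; q] = 0 -> u = 0.

End PolynomialSubring.

Definition etale_polynomial_extension (K : comNzRingType)
    (p q : {mpoly K[2]}) : Prop :=
  algebraically_independent p q /\ etale (incl (poly_subring p q)).

(* Main.v *)
From HB Require Import structures.
Require Import Defs.
From mathcomp Require Import all_boot all_order all_algebra.
From mathcomp Require Import boolp classical_sets reals.
From mathcomp Require Import complex mpoly.
From mathcomp Require Import ring zify.

Set Implicit Arguments.
Unset Strict Implicit.
Unset Printing Implicit Defensive.

Import GRing.Theory Pdiv.Idomain.
Local Open Scope ring_scope.

(** Write [B = K[x,y]], let [phi : B -> B] be the substitution [u |-> u(p,q)],
    which is injective and etale with image [K[p,q]], and let
    [psi = phi o phi].  The map [psi] is again etale and is the substitution of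
    the polynomials [phi p] and [phi q], so the hypothesis applies to it.

    Geometrically, let [F] be the endomorphism of the plane defined by [phi], let
    [X'] be the normalization of the target of [F] in its source, and [X] the
    same for [F o F].  The boundary curves of the plane in [X] are of two sorts:
    those lying over the boundary of [X'], and those lying over the plane in
    [X'], at which the first [F] already goes to infinity.  If [F] is not
    finite, there are curves of both sorts.  Boundary curves correspond to
    associated primes of [B] over the integral closure [C] of [psi(B)], so there
    are at least two of these, which contradicts primariness.  The proof is an
    algebraic form of this remark.

    Suppose that [b] in [B] is not integral over [phi], and let [P] be the only
    associated prime of [B / C].
    - [phi b] is not in [C], so its denominators [{s in C | s (phi b) in C}] lie
      in [P], by [prime_annihilator_multiple].  In particular [phi c] is in
      [P] as soon as [c] and [c b] are integral over [phi].
    - A power of each element of [P] multiplies [b] into [C]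
      ([nilpotent_of_unique_annihilator]).  So for every such [c] some
      [(phi c)^N b] is integral over [phi].
    - If no prime element of [B] divided all those [c], then [b] itself would
      be integral over [phi], by the integral closedness expressed in
      [integral_of_coprime_denominators].
    - Such a prime would divide all the coefficients [phi g_i] of a primitive
      equation of [b] over [phi] ([divides_coef_of_denominators]), although the
      [g_i] have no common prime divisor.  An etale [phi] does not contract a
      curve to a point, which is to say that it preserves this absence of a
      common prime divisor ([formally_etale_coprime]).

    Associated primes are obtained as maximal annihilators, which exist because
    [B] is factorial and has finite rank over [psi(B)]; the rank is bounded by
    counting dimensions ([rank_comp_mpoly]). *)

(** * Prime elements and factorial domains *)

Section Factorial.
Variable R : idomainType.
Implicit Types x y z : R.

Definition divides x y := exists z, y = z * x.

Definition prime_elt x :=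
  [/\ x != 0, x \isn't a GRing.unit &
      forall y z, divides x (y * z) -> divides x y \/ divides x z].

Definition prime_factored x := exists u (s : seq R),
  [/\ u \is a GRing.unit, {in s, forall y, prime_elt y} &
      x = u * \prod_(y <- s) y].

Definition factorial_domain := forall x, x != 0 -> prime_factored x.

(** For a two-dimensional factorial domain this says that [S] generates an ideal
    of codimension at least 2, which is weaker than generating the unit
    ideal. *)
Definition coprime_set (S : R -> Prop) :=
  forall pi, prime_elt pi -> ~ (forall x, S x -> divides pi x).

Lemma divides0 x : divides x 0.
Proof. by exists 0; rewrite mul0r. Qed.

Lemma dividesxx x : divides x x.
Proof. by exists 1; rewrite mul1r. Qed.

Lemma dividesD x y z : divides x y -> divides x z -> divides x (y + z).
Proof. by move=> [a ->] [b ->]; exists (a + b); rewrite mulrDl. Qed.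

Lemma dividesB x y z : divides x y -> divides x z -> divides x (y - z).
Proof. by move=> [a ->] [b ->]; exists (a - b); rewrite mulrBl. Qed.

Lemma divides_mull x y z : divides x z -> divides x (y * z).
Proof. by move=> [a ->]; exists (y * a); rewrite mulrA. Qed.

Lemma divides_mulr x y z : divides x y -> divides x (y * z).
Proof. by rewrite mulrC; apply: divides_mull. Qed.

Lemma divides_trans y x z : divides x y -> divides y z -> divides x z.
Proof. by move=> xy [a ->]; apply: divides_mull. Qed.

Lemma divides_sum x (I : Type) (r : seq I) (P : pred I) (F : I -> R) :
  (forall i, P i -> divides x (F i)) -> divides x (\sum_(i <- r | P i) F i).
Proof.
move=> dF; apply: big_rec => [|i y Pi]; first exact: divides0.
exact/dividesD/dF.
Qed.

Lemma prime_neq0 x : prime_elt x -> x != 0.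
Proof. by case. Qed.

Lemma prime_mul x y z :
  prime_elt x -> divides x (y * z) -> divides x y \/ divides x z.
Proof. by case=> _ _; apply. Qed.

Lemma prime_ndivides_unit x u :
  prime_elt x -> u \is a GRing.unit -> ~ divides x u.
Proof.
by case=> _ /negP xN _ uU [a ua]; apply: xN; move: uU; rewrite ua unitrM => /andP[].
Qed.

Lemma prime_exp x y n : prime_elt x -> divides x (y ^+ n) -> divides x y.
Proof.
move=> px; elim: n => [|n IH]; first by move/(prime_ndivides_unit px (unitr1 R)).
by rewrite exprS => /(prime_mul px)[].
Qed.

(** One prime divides another only if they are associated: the cofactor cannot
    be divisible by the second one, so it is a unit. *)
Lemma prime_divides_sym x y :
  prime_elt x -> prime_elt y -> divides x y -> divides y x.
Proof.
move=> px py [a ya]; have [[b ab]|//] : divides y a \/ divides y x.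
  by apply: (prime_mul py); rewrite -ya; apply: dividesxx.
case: (prime_ndivides_unit px (unitr1 R)); exists b; apply: (mulfI (prime_neq0 py)).
by rewrite mulr1 {1}ya ab; ring.
Qed.

Lemma unit_factored u : u \is a GRing.unit -> prime_factored u.
Proof. by exists u, [::]; split=> //; rewrite big_nil mulr1. Qed.

Lemma prime_factored_self x : prime_elt x -> prime_factored x.
Proof.
move=> px; exists 1, [:: x]; split; first exact: unitr1.
  by move=> y; rewrite inE => /eqP ->.
by rewrite big_seq1 mul1r.
Qed.

Lemma prime_factoredM x y :
  prime_factored x -> prime_factored y -> prime_factored (x * y).
Proof.
move=> [u [s [uU ps ->]]] [v [t [vU pt ->]]]; exists (u * v), (s ++ t); split.
- by rewrite unitrM uU.
- by move=> z; rewrite mem_cat => /orP[/ps|/pt].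
- by rewrite big_cat /=; ring.
Qed.

Hypothesis factR : factorial_domain.

Lemma factorial_ind (P : R -> Prop) :
    (forall u, u \is a GRing.unit -> P u) ->
    (forall pi x, prime_elt pi -> x != 0 -> P x -> P (pi * x)) ->
  forall x, x != 0 -> P x.
Proof.
move=> P1 Ppi x /factR[u [s [uU ps ->]]]; elim: s ps => [|y s IH] ps.
  by rewrite big_nil mulr1; apply: P1.
have ps' : {in s, forall y, prime_elt y} by move=> z zs; apply: ps; rewrite inE zs orbT.
rewrite big_cons mulrCA; apply: Ppi (IH ps'); first by apply: ps; rewrite mem_head.
rewrite mulf_neq0 //; first by apply: contraTneq uU => ->; rewrite unitr0.
by rewrite prodf_seq_neq0; apply/allP => z /ps' /prime_neq0 ->.
Qed.

Lemma coprime_set_unit x : x != 0 ->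
  (forall pi, prime_elt pi -> ~ divides pi x) -> x \is a GRing.unit.
Proof.
move: x; apply: factorial_ind => // pi x ppi _ _ /(_ pi ppi)[].
exact/divides_mulr/dividesxx.
Qed.


(** Cancelling a prime divisor shortens a given factorization, whichever prime
    is cancelled, so the number of factors is a decreasing measure. *)
Lemma prime_factor_cancel (pi u : R) (s : seq R) : prime_elt pi ->
    u \is a GRing.unit -> {in s, forall y, prime_elt y} ->
    divides pi (u * \prod_(y <- s) y) ->
  exists v (t : seq R),
    [/\ v \is a GRing.unit, {in t, forall y, prime_elt y},
        (size t < size s)%N & u * \prod_(y <- s) y = pi * (v * \prod_(y <- t) y)].
Proof.
move=> ppi uU; elim: s => [|y s IH] ps.
  by rewrite big_nil mulr1 => /(prime_ndivides_unit ppi uU).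
have ps' : {in s, forall y, prime_elt y} by move=> z zs; apply: ps; rewrite inE zs orbT.
have py : prime_elt y by apply: ps; rewrite mem_head.
rewrite big_cons mulrCA => /(prime_mul ppi)[piy|/(IH ps')].
  have [a ya] := piy; have [b pib] := prime_divides_sym ppi py piy.
  have ab : b * a = 1.
    by apply: (mulIf (prime_neq0 ppi)); rewrite mul1r {2}pib ya mulrA.
  have aU : a \is a GRing.unit by apply/unitrP; exists b; rewrite ab mulrC ab.
  exists (a * u), s; split => //; first by rewrite unitrM aU.
  by rewrite ya; ring.
move=> [v [t [vU pt lt ->]]]; exists v, (y :: t); split=> //.
  by move=> z; rewrite inE => /predU1P[->|/pt].
by rewrite big_cons; ring.
Qed.

(** A greatest common divisor of an arbitrary family is extracted by cancelling
    common primes one at a time, which stops since each one shortens the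
    factorization of the nonzero member [f i0]. *)
Lemma primitive_part (I : Type) (f : I -> R) (i0 : I) : f i0 != 0 ->
  exists d g, [/\ d != 0, forall i, f i = d * g i &
                  coprime_set (fun x => exists i, x = g i)].
Proof.
move=> /[dup] f0 /factR[u [s [uU ps fs]]].
have [n] := ubnP (size s); elim: n => // n IH in f u s uU ps fs f0 *.
rewrite ltnS => sn; have [cf|] := EM (coprime_set (fun x => exists i, x = f i)).
  by exists 1, f; split=> // [|i]; rewrite ?oner_neq0 ?mul1r.
move=> /existsNP[pi /not_implyP[ppi /contrapT dpi]].
have /choice[g fg] : forall i, exists y, f i = y * pi.
  by move=> i; apply: dpi; exists i.
have [|v [t [vU pt ts ev]]] := prime_factor_cancel ppi uU ps.
  by rewrite -fs; apply: dpi; exists i0.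
have gi0 : g i0 = v * \prod_(y <- t) y.
  by apply: (mulIf (prime_neq0 ppi)); rewrite -fg fs ev mulrC.
have [||d [h [d0 gh ch]]] := IH g v t vU pt gi0; first 2 last.
- exists (d * pi), h; split=> // [|i]; first by rewrite mulf_neq0 // prime_neq0.
  by rewrite fg gh; ring.
- by apply: contraNneq f0 => g0; rewrite fg g0 mul0r.
- exact: leq_trans ts sn.
Qed.

End Factorial.

(** * Gauss's lemma *)

Section GaussLemma.
Variable R : idomainType.
Implicit Types (c : R) (f g h : {poly R}).

Definition primitive_poly f := coprime_set (fun c => exists i : nat, c = f`_i).

Lemma polyC_divides c f :
  (forall i, divides c f`_i) -> divides c%:P f.
Proof.
move=> /choice[q fq]; exists (\poly_(i < size f) q i); apply/polyP => i.
rewrite coefMC coef_poly; case: ltnP => [_|le]; first exact: fq.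
by rewrite mul0r nth_default.
Qed.

Lemma divides_coef c f i : divides c%:P f -> divides c f`_i.
Proof. by move=> [q ->]; exists q`_i; rewrite coefMC. Qed.

Lemma ex_least (P : nat -> Prop) :
  (exists n, P n) -> exists n, P n /\ forall m, P m -> (n <= m)%N.
Proof.
move=> [n Pn]; have exP : exists n, `[< P n >] by exists n; apply/asboolP.
exists (ex_minn exP); case: ex_minnP => m /asboolP Pm minm; split=> // k Pk.
exact/minm/asboolP.
Qed.

(** If [c] divides neither [f] nor [g], consider their first coefficients [f_i]
    and [g_j] not divisible by [c]: modulo [c], the coefficient of degree
    [i + j] of [f * g] is [f_i * g_j]. *)
Lemma prime_polyC c : prime_elt c -> prime_elt c%:P.
Proof.
move=> pc; split=> [||f g fg].
- by rewrite polyC_eq0 prime_neq0.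
- by apply: contra (let: And3 _ h _ := pc in h); rewrite poly_unitE coefC => /andP[].
have [df|/existsNP nf] := EM (forall i, divides c f`_i).
  by left; apply: polyC_divides.
have [dg|/existsNP ng] := EM (forall i, divides c g`_i).
  by right; apply: polyC_divides.
have [i [fi mini]] := ex_least nf; have [j [gj minj]] := ex_least ng.
suff /(prime_mul pc)[] : divides c (f`_i * g`_j) by [].
have := divides_coef (i + j) fg; rewrite coefM.
have ilt : (i < (i + j).+1)%N by rewrite ltnS leq_addr.
rewrite (bigD1 (Ordinal ilt)) //= addKn => dS.
rewrite -[X in divides c X](addrK
  (\sum_(k < (i + j).+1 | k != Ordinal ilt) f`_k * g`_(i + j - k))).
apply: dividesB => //; apply: divides_sum => k ki.
have [klt|kge] := ltnP k i.
  apply: divides_mulr; apply: contrapT => /mini; by rewrite leqNgt klt.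
apply: divides_mull; apply: contrapT => /minj; rewrite leqNgt; case/negP.
have {}ki : (i < k)%N.
  by rewrite ltn_neqAle kge andbT; apply: contra ki => /eqP ik; apply/eqP/val_inj.
rewrite ltn_subLR; last by rewrite -ltnS.
by rewrite ltn_add2r.
Qed.

Hypothesis factR : factorial_domain R.

(** Divisibility over the field of fractions by a primitive polynomial is
    divisibility: each prime factor of the denominator [c] can be cancelled
    because it divides [f * g] without dividing [g]. *)
Lemma primitive_divides c f g h : c != 0 -> primitive_poly g ->
  c *: h = f * g -> divides g h.
Proof.
move=> c0 pg; move: c c0 f; apply: (factorial_ind factR) => [u uU|pi c ppi c0 IH] f.
  move=> e; exists (u^-1 *: f); rewrite -scalerAl -e scalerA mulVr ?scale1r //.
move=> e; have /(prime_mul (prime_polyC ppi))[[k fk]|/divides_coef dg] : divides pi%:P (f * g).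
- by exists (c *: h); rewrite -e [RHS]mulrC mul_polyC scalerA.
- apply: (IH k); apply: (mulfI (prime_neq0 (prime_polyC ppi))).
  by rewrite mul_polyC scalerA e fk; ring.
- by case: (pg pi ppi) => _ [i ->]; apply: dg.
Qed.

(** The relation [%|] of polynomials over a domain is divisibility over its
    field of fractions. *)
Lemma primitive_dvdp g h : primitive_poly g -> g %| h -> divides g h.
Proof. by move=> pg /dvdpP[[c q] /= c0 e]; apply: primitive_divides c0 pg e. Qed.

Lemma primitive_poly_part f : f != 0 -> exists c g,
  [/\ c != 0, primitive_poly g & f = c *: g].
Proof.
rewrite -lead_coef_eq0 => f0.
have [d [a [d0 fa ca]]] := primitive_part factR (f := nth 0 f) f0.
exists d, (\poly_(i < size f) a i); have ai i : (\poly_(i < size f) a i)`_i = a i.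
  rewrite coef_poly; case: ltnP => // le; apply: (mulfI d0).
  by rewrite -fa mulr0 nth_default.
split=> //; last by apply/polyP => i; rewrite coefZ ai.
by move=> pi ppi dpi; apply: (ca pi ppi) => x [i ->]; apply: dpi; exists i; rewrite ai.
Qed.

(** When [f] divides [g * h], the primitive part of [gcdp f g] divides [f].  If
    [f] has no proper factorization, that part has the degree of [f], and then
    [f] divides [g], or it is constant, and then [f] divides [h]. *)
Lemma primitive_prime_or_factor f : primitive_poly f -> (1 < size f)%N ->
    prime_elt f \/
  exists g h, [/\ f = g * h, (size g < size f)%N & (size h < size f)%N].
Proof.
move=> pf sf; apply: contrapT => /not_orP[npf nfact]; apply: npf.
have f0 : f != 0 by rewrite -size_poly_gt0 (ltn_trans _ sf).
split=> // [|g h fgh].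
  by rewrite poly_unitE gtn_eqF.
have [g0|gN0] := eqVneq g 0; first by left; rewrite g0; apply: divides0.
have d0 : gcdp f g != 0 by rewrite gcdp_eq0 negb_and f0.
have [c [d [c0 pd cd]]] := primitive_poly_part d0.
have [k fk] : divides d f.
  by apply: primitive_dvdp => //; rewrite -(dvdpZl _ _ c0) -cd dvdp_gcdl.
have k0 : k != 0 by apply: contraNneq f0 => k0; rewrite fk k0 mul0r.
have dn0 : d != 0 by apply: contraNneq f0 => k0'; rewrite fk k0' mulr0.
have sfk : size f = (size k + size d).-1 by rewrite fk size_mul.
have [sk|sk] := ltnP (size k) (size f).
  have {}sd : (size f <= size d)%N.
    by rewrite leqNgt; apply/negP => sd; apply: nfact; exists k, d.
  have fd : f %= d.
    rewrite eqp_sym -dvdp_size_eqp; last by rewrite fk dvdp_mull.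
    by rewrite eqn_leq sd andbT dvdp_leq // fk dvdp_mull.
  left; apply: primitive_dvdp => //; rewrite (eqp_dvdl _ fd).
  by rewrite -(dvdpZl _ _ c0) -cd dvdp_gcdr.
right; apply: primitive_dvdp => //.
have /(primitive_dvdp pf) : f %| g * h by case: fgh => q ->; rewrite dvdp_mull.
case=> q e; rewrite -(Gauss_dvdpr _ (_ : coprimep f g)); first by rewrite e dvdp_mull.
rewrite coprimep_def cd size_scale //.
move: sk; rewrite sfk; move: dn0 k0; rewrite -!size_poly_gt0; lia.
Qed.

Lemma primitive_factored f : f != 0 -> primitive_poly f -> prime_factored f.
Proof.
have [n] := ubnP (size f); elim: n => // n IH in f *.
rewrite ltnS => sn f0 pf; have [sf|sf] := ltnP 1 (size f).
  have [/prime_factored_self//|[g [h [fgh sg sh]]]] := primitive_prime_or_factor pf sf.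
  have [g0 h0] : g != 0 /\ h != 0 by apply/andP; rewrite -negb_or -mulf_eq0 -fgh.
  rewrite fgh; apply: prime_factoredM; apply: IH => //; try exact: leq_trans sn.
    move=> pi ppi dg; apply: (pf pi ppi) => x [i ->]; apply: divides_coef.
    rewrite fgh; apply/divides_mulr/polyC_divides => j; apply: dg; by exists j.
  move=> pi ppi dg; apply: (pf pi ppi) => x [i ->]; apply: divides_coef.
  rewrite fgh; apply/divides_mull/polyC_divides => j; apply: dg; by exists j.
have fc := size1_polyC sf; rewrite fc; apply: unit_factored.
rewrite poly_unitE coefC eqxx size_polyC.
have c0 : f`_0 != 0 by apply: contraNneq f0 => c0; rewrite fc c0.
rewrite c0 /=; apply: coprime_set_unit => // pi ppi dpi.
apply: (pf pi ppi) => x [i ->]; rewrite fc coefC.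
by case: (i == 0%N) => //; apply: divides0.
Qed.

Theorem factorial_poly : factorial_domain {poly R}.
Proof.
move=> f f0; have [c [g [c0 pg fg]]] := primitive_poly_part f0.
rewrite fg -mul_polyC; apply: prime_factoredM; last first.
  by apply: primitive_factored => //; apply: contraNneq f0 => g0; rewrite fg g0 scaler0.
have [u [s [uU ps ->]]] := factR c0.
exists u%:P, [seq x%:P | x <- s]; split.
- by rewrite poly_unitE coefC eqxx size_polyC uU andbT (_ : u != 0) //;
    apply: contraTneq uU => ->; rewrite unitr0.
- by move=> _ /mapP[x /ps /prime_polyC px ->].
- by rewrite polyCM rmorph_prod big_map.
Qed.

End GaussLemma.

Lemma factorial_field (F : fieldType) : factorial_domain F.
Proof. by move=> x x0; apply: unit_factored; rewrite unitfE. Qed.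

(** * Integral elements over a factorial domain *)

Lemma integral_exp (A B : comNzRingType) (iota : {rmorphism A -> B}) b n :
  integralOver iota b -> integralOver iota (b ^+ n).
Proof.
move=> bI; elim: n => [|n IH]; first exact: integral1.
by rewrite exprS; apply: integral_mul.
Qed.

Section IntegralOverFactorial.
Variables (A B : idomainType) (iota : {rmorphism A -> B}).
Implicit Types (a : A) (b c : B).

(** Multiplying [f] by [(lead_coef f) ^+ (d - 1)], where [d] is its degree,
    gives a monic equation of [lead_coef f * b]. *)
Lemma integral_lead_coef (f : {poly B}) b :
    (forall i, integralOver iota f`_i) -> root f b ->
  integralOver iota (lead_coef f * b).
Proof.
move=> fI fb; have [sf|sf] := leqP (size f) 1.
  have f0 : f = 0.
    apply/eqP; move: fb; rewrite [in root _ _](size1_polyC sf) rootC => /eqP f0.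
    by rewrite (size1_polyC sf) f0.
  by rewrite f0 lead_coef0 mul0r; apply: integral0.
set L := lead_coef f; pose d := (size f).-1.
have d_gt0 : (0 < d)%N by rewrite /d; lia.
pose r := \poly_(i < d) (f`_i * L ^+ (d.-1 - i)).
have q_monic : 'X^d + r \is monic.
  rewrite monicE lead_coefDl ?lead_coefXn // size_polyXn.
  by rewrite ltnS size_poly.
apply: (integral_root_monic q_monic).
  rewrite rootE hornerD hornerXn /r horner_poly exprMn.
  rewrite (eq_bigr (fun i : 'I_d => L ^+ d.-1 * (f`_i * b ^+ i))); last first.
    move=> i _; have -> : L ^+ d.-1 = L ^+ (d.-1 - i) * L ^+ i.
      by rewrite -exprD subnK //; have := ltn_ord i; lia.
    by rewrite exprMn; ring.
  rewrite -mulr_sumr -{1}(prednK d_gt0) exprS -mulrA mulrCA -mulrDr.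
  move: fb; rewrite rootE horner_coef -(prednK (ltnW sf)) -/d big_ord_recr /= => /eqP.
  by rewrite addrC => ->; rewrite mulr0.
apply/integral_poly => i; rewrite coefD coefXn coef_poly; apply: integral_add.
  by case: eqP => _; [apply: integral1 | apply: integral0].
case: ifP => _; last exact: integral0.
by apply: integral_mul => //; apply: integral_exp; apply: fI.
Qed.

(** The coefficients of an equation of [b] are combinations of denominators of
    [b], that is of integral [c] with [c * b] integral.  Indeed the leading
    coefficient [L] is one by [integral_lead_coef], and replacing the two top
    terms [L X^(d+1) + f_d X^d] by [(L b + f_d) X^d] gives an equation of
    smaller degree which still has integral coefficients. *)
Lemma divides_coef_of_denominators (f : {poly B}) b rho :
    (forall i, integralOver iota f`_i) -> root f b ->
    (forall c, integralOver iota c -> integralOver iota (c * b) -> divides rho c) ->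
  forall i, divides rho f`_i.
Proof.
move=> fI fb rho_den.
have [n] := ubnP (size f); elim: n => // n IH in f fI fb *; rewrite ltnS => sf.
have LI := integral_lead_coef fI fb.
have dL : divides rho (lead_coef f) by apply: rho_den => //; apply: fI.
have [sf1|sf1] := leqP (size f) 1.
  move=> [|i]; last by rewrite nth_default ?(leq_trans sf1) //; apply: divides0.
  by move: dL; rewrite /lead_coef; case: (size f) sf1 => [|[]].
set L := lead_coef f in LI dL *; pose d := (size f).-2.
have sfd : size f = d.+2 by rewrite /d; lia.
have fd1 : f`_d.+1 = L by rewrite /L lead_coefE sfd.
pose f' := f - L *: 'X^(d.+1) + (L * b) *: 'X^d.
have f'E i : f'`_i = f`_i - L *+ (i == d.+1) + (L * b) *+ (i == d).
  by rewrite !coefD coefN !coefZ !coefXn !mulr_natr.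
have dLb k : divides rho (L *+ k).
  by rewrite -mulr_natr; apply: divides_mulr.
have f'I i : integralOver iota f'`_i.
  rewrite f'E; apply: integral_add; first apply: integral_sub => //.
    by rewrite -mulr_natr; apply: integral_mul (integral_nat _ _); apply: fI.
  by rewrite -mulr_natr; apply: integral_mul (integral_nat _ _).
have f'b : root f' b.
  move: fb; rewrite !rootE !hornerE => /eqP ->.
  by apply/eqP; rewrite exprS; ring.
have sf' : (size f' < n)%N.
  apply: leq_trans sf; rewrite sfd ltnS; apply/leq_sizeP => j.
  rewrite leq_eqVlt f'E => /predU1P[<-|lt].
    by rewrite eqxx fd1 mulr1n gtn_eqF // addr0 subrr.
  by rewrite nth_default ?sfd // !gtn_eqF ?addr0 ?subr0 // ltnW.
move=> i; have := IH _ f'I f'b sf' i; rewrite f'E => h.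
rewrite -[f`_i](_ : f`_i - L *+ (i == d.+1) + L * b *+ (i == d)
  + (L *+ (i == d.+1) - L * b *+ (i == d)) = _); last by ring.
by apply: dividesD => //; apply: dividesB => //; rewrite -mulrnAl; apply: divides_mulr.
Qed.

Definition algebraic_elt b := exists2 f : {poly A}, f != 0 & root (map_poly iota f) b.

Hypothesis iota_inj : injective iota.
Hypothesis factA : factorial_domain A.

Lemma algebraic_denominator b : algebraic_elt b ->
  exists2 t, t != 0 & integralOver iota (iota t * b).
Proof.
move=> [f f0 fb]; exists (lead_coef f); first by rewrite lead_coef_eq0.
rewrite -lead_coef_map_inj ?rmorph0 //; apply: integral_lead_coef fb => i.
by rewrite coef_map; apply: integral_id.
Qed.

Lemma primitive_minimal_poly b : algebraic_elt b -> exists g : {poly A},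
  [/\ g != 0, primitive_poly g, root (map_poly iota g) b &
      forall h, root (map_poly iota h) b -> divides g h].
Proof.
move=> [f0 f00 f0b].
have [] := @ex_least (fun n => exists f : {poly A},
  [/\ f != 0, root (map_poly iota f) b & size f = n]).
  by exists (size f0), f0.
move=> _ [[f [fN0 fb <-]] fmin].
have [c [g [c0 pg fg]]] := primitive_poly_part factA fN0.
have gN0 : g != 0 by apply: contraNneq fN0 => g0; rewrite fg g0 scaler0.
have gb : root (map_poly iota g) b.
  move: fb; rewrite fg map_polyZ rootZ //.
  by rewrite -(rmorph0 iota) inj_eq.
have sg : size f = size g by rewrite fg size_scale.
exists g; split=> // h hb; apply: primitive_dvdp => //.
apply/modp_eq0P/eqP; apply: contraT => rN0.
have /fmin : exists f' : {poly A}, [/\ f' != 0, root (map_poly iota f') b &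
     size f' = size (h %% g)].
  exists (h %% g); split=> //.
  have := divp_eq h g => /(congr1 (map_poly iota))/(congr1 (horner^~ b)).
  rewrite rmorphD rmorphM /= map_polyZ !hornerE.
  move/rootP: gb => ->; move/rootP: hb => ->; rewrite !mulr0 add0r => e.
  by apply/rootP.
by rewrite sg leqNgt ltn_modpN0.
Qed.

(** If [iota s * b] is integral, the primitive minimal polynomial [g] of [b]
    divides [h(s X)] for some monic [h], so its leading coefficient divides a
    power of [s].  When this holds for a family of [s] without common prime
    divisor, the leading coefficient of [g] is a unit. *)
Lemma integral_of_coprime_denominators b : algebraic_elt b ->
    coprime_set (fun s => integralOver iota (iota s * b)) ->
  integralOver iota b.
Proof.
move=> /primitive_minimal_poly[g [g0 pg gb gmin]] cop.
have lead_dvd s : integralOver iota (iota s * b) ->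
    exists e, divides (lead_coef g) (s ^+ e).
  move=> [h h_monic hsb].
  have [|k hk] := gmin (h \Po (s *: 'X)).
    move: hsb; rewrite map_comp_poly map_polyZ map_polyX !rootE horner_comp.
    by rewrite !hornerE.
  have [->|s0] := eqVneq s 0; first by exists 1%N; exists 0; rewrite expr1 mul0r.
  exists (size h).-1, (lead_coef k); rewrite -lead_coefM -hk.
  rewrite lead_coef_comp ?size_scale ?size_polyX //.
  by rewrite (monicP h_monic) mul1r lead_coefZ lead_coefX mulr1.
have LU : lead_coef g \is a GRing.unit.
  apply: (coprime_set_unit factA); first by rewrite lead_coef_eq0.
  move=> pi ppi dpi; apply: (cop pi ppi) => s /lead_dvd[e] /(divides_trans dpi).
  exact: prime_exp.
exists ((lead_coef g)^-1 *: g).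
  by rewrite monicE lead_coefZ mulVr.
by move/rootP: gb => gb; apply/rootP; rewrite map_polyZ hornerZ gb mulr0.
Qed.

End IntegralOverFactorial.

(** * Associated primes of the integral closure *)

Section PrimeAnnihilators.
Variables (A B : idomainType) (iota : {rmorphism A -> B}).
Implicit Types (b c r x y : B).

(** The field of fractions of [B] has degree at most [n] over that of [A]. *)
Definition rank_le n := forall c : 'I_n.+1 -> B, exists u : 'I_n.+1 -> A,
  (exists i, u i != 0) /\ \sum_(i < n.+1) iota (u i) * c i = 0.

Local Notation C := (integralOver iota).

(** The annihilator of the class of [b] modulo the integral closure is a prime
    ideal of this closure. *)
Definition prime_annihilator b :=
  ~ C b /\ forall x y, C x -> C y -> C (x * y * b) -> C (x * b) \/ C (y * b).

Hypothesis iota_inj : injective iota.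
Hypothesis factA : factorial_domain A.
Variable n : nat.
Hypothesis rankB : rank_le n.

Lemma algebraic_of_rank b : algebraic_elt iota b.
Proof.
have [u [[i ui] su]] := rankB (fun i => b ^+ i).
exists (\poly_(i < n.+1) (if insub i is Some j then u j else 0)).
  apply: contra ui => /eqP /(congr1 (fun p : {poly A} => p`_i)).
  by rewrite coef_poly ltn_ord valK coef0 => ->.
apply/rootP; rewrite -su (@horner_coef_wide _ n.+1); last first.
  exact: leq_trans (size_poly _ _) (size_poly _ _).
by apply: eq_bigr => j _; rewrite coef_map coef_poly ltn_ord valK.
Qed.

Lemma integral_of_two_denominators pi u b : prime_elt pi -> ~ divides pi u ->
  C (iota pi * b) -> C (iota u * b) -> C b.
Proof.
move=> ppi ndu piI uI.
apply: (integral_of_coprime_denominators iota_inj factA (algebraic_of_rank b)).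
move=> rho prho drho; apply: ndu; apply: divides_trans (drho u uI).
exact/(prime_divides_sym prho ppi)/drho.
Qed.

(** If there were no such [r], one would obtain multiples [b_k = r_k b] with a
    strictly increasing sequence of annihilators, say with [y_k] killing
    [b_(k+1)] but not [b_k] modulo [C].  Take a relation
    [sum_k iota (v_k) y_k = 0] for [k <= n], whose coefficients are not all
    divisible by [pi], and the largest [i] such that [pi] does not divide [v_i].
    Multiply it by [b_i]: the terms with [k < i] are in [C] since [y_k] kills
    [b_i], and those with [k > i] since [pi] kills [b].  So both [v_i] and [pi]
    multiply [y_i b_i] into [C], hence [y_i b_i] is in [C], a contradiction.
    The predicate [Q] selects the multiples among which the annihilator is
    maximal. *)
Lemma maximal_annihilator pi b (Q : B -> Prop) : prime_elt pi ->
    C (iota pi * b) -> Q b ->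
  exists r, [/\ C r, Q (r * b) &
    forall x y, C x -> Q (x * (r * b)) -> C y ->
      C (y * (x * (r * b))) -> C (y * (r * b))].
Proof.
move=> ppi pib Qb; apply: contrapT => nmax.
have /choice[F stepF] : forall r, exists xy : B * B, C r -> Q (r * b) ->
    [/\ C xy.1, Q (xy.1 * (r * b)), C xy.2,
        C (xy.2 * (xy.1 * (r * b))) & ~ C (xy.2 * (r * b))].
  move=> r; apply: contrapT => /forallNP nxy; apply: nmax.
  have [Cr Qr] : C r /\ Q (r * b).
    by have /not_implyP[? /not_implyP[]] := nxy (0, 0).
  exists r; split=> // x y Cx Qx Cy yx; apply: contrapT => ny.
  by apply: (nxy (x, y)).
pose r k := iter k (fun r => (F r).1 * r) 1.
pose y k := (F (r k)).2.
have CQr k : C (r k) /\ Q (r k * b).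
  elim: k => [|k [Ck Qk]]; first by rewrite mul1r; split=> //; apply: integral1.
  have [Cx Qx _ _ _] := stepF _ Ck Qk.
  by rewrite /r iterS -/(r k) -mulrA; split=> //; apply: integral_mul.
have stepr k := let: conj Ck Qk := CQr k in stepF (r k) Ck Qk.
have Cy k : C (y k) by case: (stepr k).
have ykk k : ~ C (y k * (r k * b)) by case: (stepr k).
have ylt k l : (k < l)%N -> C (y k * (r l * b)).
  move=> kl; rewrite -(subnK kl); elim: (l - k.+1)%N => [|m IH].
    have [_ _ _] := stepr k; rewrite add0n /r iterS mulrA -/(r k) -/(y k).
    by rewrite mulrA -!mulrA.
  rewrite addSn /r iterS -/(r _) -mulrA mulrCA; apply: integral_mul IH.
  by case: (stepr (m + k.+1)%N).
have [u [[i0 ui0] su]] := rankB (fun i => y i).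
have [d [v [d0 uv cv]]] := primitive_part factA ui0.
have sv : \sum_(i < n.+1) iota (v i) * y i = 0.
  have id0 : iota d != 0 by rewrite -(rmorph0 iota) inj_eq.
  apply: (mulfI id0); rewrite mulr0 -[RHS]su mulr_sumr.
  by apply: eq_bigr => i _; rewrite uv rmorphM mulrA.
have [i1 ndi1] : exists i, ~ divides pi (v i).
  by apply/existsNP => dv; apply: (cv pi ppi) => x [i ->].
have ndi1' : `[< ~ divides pi (v i1) >] by apply/asboolP.
case: (@arg_maxnP _ i1 (fun i => `[< ~ divides pi (v i) >])
  (fun i => i : nat) ndi1') => i /asboolP ndi imax.
apply: (ykk i); apply: (integral_of_two_denominators ppi ndi).
  rewrite mulrCA [iota pi * _]mulrCA; apply: integral_mul => //.
  by apply: integral_mul => //; case: (CQr i).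
have -> : iota (v i) * (y i * (r i * b)) =
    - \sum_(j < n.+1 | j != i) iota (v j) * y j * (r i * b).
  move: sv; rewrite (bigD1 i) //= => /eqP; rewrite addr_eq0 => /eqP sv.
  by rewrite mulrA sv -mulr_suml mulNr.
apply: integral_opp; apply: big_rec; first exact: integral0.
move=> j s ji Cs; apply: integral_add => //; rewrite -mulrA.
have [lt|ge] := ltnP j i.
  by apply: integral_mul (integral_id _ _) _; apply: ylt.
have [w ->] : divides pi (v j).
  apply: contrapT => ndj; have := imax j; rewrite asboolT // => /(_ isT) le.
  by case/eqP: ji; apply/val_inj/eqP; rewrite eqn_leq ge andbT.
rewrite rmorphM -mulrA; apply: integral_mul (integral_id _ _) _.
rewrite mulrCA [iota pi * _]mulrCA; apply: integral_mul => //.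
by apply: integral_mul => //; case: (CQr i).
Qed.

(** Among the multiples of [b] outside [C], a maximal annihilator is prime; a
    first multiple makes [maximal_annihilator] applicable by removing from a
    denominator of [b] all its prime factors but one. *)
Lemma prime_annihilator_multiple b : ~ C b ->
  exists2 r, C r & prime_annihilator (r * b).
Proof.
move=> nb; have [t t0 tb] := algebraic_denominator iota_inj (algebraic_of_rank b).
have [r [pi [Cr ppi nrb pirb]]] : exists r pi,
    [/\ C r, prime_elt pi, ~ C (r * b) & C (iota pi * (r * b))].
  move: t t0 tb; apply: (factorial_ind factA) => [u uU|pi x ppi x0 IH].
    move=> ub; case: nb; rewrite -[b]mul1r -(rmorph1 iota) -(mulVr uU) rmorphM -mulrA.
    exact: integral_mul (integral_id _ _) _.
  rewrite rmorphM -mulrA => pixb; have [/IH//|nxb] := EM (C (iota x * b)).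
  by exists (iota x), pi; split=> //; apply: integral_id.
have [r' [Cr' nr'b max]] := maximal_annihilator (Q := fun b => ~ C b) ppi pirb nrb.
exists (r' * r); rewrite -?mulrA; first exact: integral_mul.
split=> // x y Cx Cy xyb; have [|nx] := EM (C (x * (r' * (r * b)))); first by left.
by right; apply: (max x) => //; rewrite mulrA [y * x]mulrC.
Qed.

(** An element of all the associated primes is nilpotent on [B / C].  By
    induction on the factorization of a denominator of [b] it suffices to treat
    [b] killed by one prime [pi].  Then the annihilators of the [s ^+ M * b]
    stop growing.  At that point a nonzero class would have a multiple with
    prime annihilator; since [s] kills that multiple, stationarity makes its
    class zero, a contradiction. *)
Lemma nilpotent_of_unique_annihilator (P : B -> Prop) s b :
    (forall m, prime_annihilator m -> forall x, C x -> P x -> C (x * m)) ->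
  C s -> P s -> exists N, C (s ^+ N * b).
Proof.
move=> annP Cs Ps; have [t t0 tb] := algebraic_denominator iota_inj (algebraic_of_rank b).
move: t t0 b tb; apply: (factorial_ind factA) => [u uU|pi x ppi x0 IH] b.
  move=> ub; exists 0%N; rewrite expr0 -(rmorph1 iota) -(mulVr uU) rmorphM -mulrA.
  exact: integral_mul (integral_id _ _) _.
rewrite rmorphM [iota pi * _]mulrC -mulrA => /IH[N]; rewrite mulrCA => sNb.
have [_ [_ [M ->]]] := maximal_annihilator
  (Q := fun b' => exists M, b' = s ^+ M * (s ^+ N * b)) ppi sNb
  (ex_intro _ 0%N (esym (mul1r _))).
move=> max; exists (M + N)%N; rewrite exprD -mulrA.
apply: contrapT => /prime_annihilator_multiple[r Cr pr].
have [nr _] := pr; apply: nr; apply: (max s) => //.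
  by exists M.+1; rewrite exprS -mulrA.
by rewrite mulrCA; apply: annP.
Qed.

End PrimeAnnihilators.

(** * An endomorphism and its square *)

Section Iteration.
Variables (B : idomainType) (phi psi : {rmorphism B -> B}).
Hypothesis psiE : forall b, psi b = phi (phi b).
Hypothesis phi_inj : injective phi.

Lemma map_poly_square (f : {poly B}) :
  map_poly psi f = map_poly phi (map_poly phi f).
Proof. by rewrite -map_poly_comp; apply: eq_map_poly. Qed.

Lemma integral_square b : integralOver phi b -> integralOver psi (phi b).
Proof.
move=> [f fm fb]; exists f => //.
by rewrite map_poly_square rootE horner_map (rootP fb) rmorph0.
Qed.

Lemma integral_square_inj b : integralOver psi (phi b) -> integralOver phi b.
Proof.
move=> [f fm]; rewrite map_poly_square rootE horner_map => /eqP fb.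
by exists f => //; apply/eqP/phi_inj; rewrite fb rmorph0.
Qed.

Lemma integral_square_sub b : integralOver psi b -> integralOver phi b.
Proof.
move=> [f fm fb]; exists (map_poly phi f); first exact: monic_map.
by rewrite -map_poly_square.
Qed.

(** The same [b] gives both sides of the contradiction: [phi b] produces
    elements [phi c] of the unique associated prime, and their nilpotence is
    applied to [b] itself. *)
Theorem integral_of_unique_prime_annihilator n m :
    factorial_domain B -> rank_le phi n -> rank_le psi m ->
    (forall S, coprime_set S -> coprime_set (fun y => exists2 x, S x & y = phi x)) ->
    (~ (forall b, integralOver psi b) -> exists P : B -> Prop, forall b,
      prime_annihilator psi b ->
      forall x, integralOver psi x -> (P x <-> integralOver psi (x * b))) ->
  forall b, integralOver phi b.
Proof.
move=> factB rank_phi rank_psi phi_cop annP b; apply: contrapT => nb.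
have psi_inj : injective psi by move=> x y; rewrite !psiE => /phi_inj/phi_inj.
have [|P PE] := annP.
  by move=> all; apply/nb/integral_square_sub/all.
have [r Cr pr] := prime_annihilator_multiple psi_inj factB rank_psi
  (fun h => nb (integral_square_inj h)).
have alg_b := algebraic_of_rank rank_phi b.
apply: nb; apply: (integral_of_coprime_denominators phi_inj factB alg_b).
move=> pi ppi dpi.
have dD c : integralOver phi c -> integralOver phi (c * b) -> divides pi c.
  move=> /integral_square Cc /integral_square; rewrite rmorphM => Ccb.
  have Pc : P (phi c).
    by apply/(PE _ pr) => //; rewrite mulrCA; apply: integral_mul.
  have [|N] := nilpotent_of_unique_annihilator psi_inj factB rank_psi b _ Cc Pc.
    by move=> m' pm x Cx /(PE _ pm); apply.
  rewrite -rmorphXn => /integral_square_sub /dpi; exact: prime_exp.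
have [g [g0 pg gb _]] := primitive_minimal_poly phi_inj factB alg_b.
apply: (phi_cop _ pg pi ppi) => _ [_ [i ->] ->].
rewrite -coef_map; apply: divides_coef_of_denominators gb dD i => i.
by rewrite coef_map; apply: integral_id.
Qed.

End Iteration.

(** * The rank of a polynomial ring over a subring *)

Lemma ord2P (i : 'I_2) : i = ord0 \/ i = ord_max.
Proof. by case: i => [[|[|//]] ?]; [left|right]; apply/val_inj. Qed.

Section Rank.
Variable K : fieldType.
Local Notation P2 := {mpoly K[2]}.

Definition mon2 (k : nat * nat) : 'X_{1..2} :=
  (U_(ord0) *+ k.1 + U_(ord_max) *+ k.2)%MM.

Lemma mon2_inj : injective mon2.
Proof.
move=> [k l] [k' l'] /mnmP e.
have := e ord0; have := e ord_max; rewrite !mnmDE !mulmnE !mnm1E /=.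
by rewrite !mul0n !mul1n !addn0 !add0n => -> ->.
Qed.

Lemma comp_mon2 (p q : P2) k :
  'X_[mon2 k] \mPo [tuple p; q] = p ^+ k.1 * q ^+ k.2.
Proof. by rewrite mpolyXD -!mpolyXn rmorphM !rmorphXn /= !comp_mpolyXU. Qed.

Lemma msizeM_leq k (f g : {mpoly K[k]}) : (msize (f * g) <= msize f + msize g)%N.
Proof.
have [->|f0] := eqVneq f 0; first by rewrite mul0r msize0.
have [->|g0] := eqVneq g 0; first by rewrite mulr0 msize0.
by rewrite msizeM // leq_pred.
Qed.

Lemma msizeX_leq n (f : {mpoly K[n]}) k : (msize (f ^+ k) <= k * msize f + 1)%N.
Proof.
elim: k => [|k IH]; first by rewrite expr0 msize1.
rewrite exprS mulSn -addnA; apply: leq_trans (msizeM_leq _ _) _.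
by rewrite leq_add2l.
Qed.

Lemma card_mon2_lt s : (#|{: 'X_{1..2 < s}}| <= s * s)%N.
Proof.
case: s => [|s].
  by rewrite leqn0; apply/eqP/eq_card0 => -[].
pose f (m : 'X_{1..2 < s.+1}) : 'I_s.+1 * 'I_s.+1 :=
  (inord (bmnm m ord0), inord (bmnm m ord_max)).
rewrite -[X in (_ <= X)%N](_ : #|{: 'I_s.+1 * 'I_s.+1}| = _); last first.
  by rewrite card_prod !card_ord.
apply: (@leq_card _ _ f) => m m' [].
have lt (k : 'X_{1..2 < s.+1}) i : (bmnm k i < s.+1)%N.
  case: k => k /= klt; apply: leq_ltn_trans klt.
  by rewrite mdegE (bigD1 i) //= leq_addr.
move=> /(congr1 (@nat_of_ord _)) + /(congr1 (@nat_of_ord _)).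
rewrite !inordK // => e0 e1; apply/val_inj/mnmP => i.
by have [->|->] := ord2P i.
Qed.

Lemma bounded_linear_dependence (I : finType) (w : I -> P2) s :
    (forall i, msize (w i) <= s)%N -> (s * s < #|I|)%N ->
  exists c : I -> K, (exists i, c i != 0) /\ \sum_i c i *: w i = 0.
Proof.
move=> ws sI.
pose M := \matrix_(i < #|I|, m < #|{: 'X_{1..2 < s}}|)
  (w (enum_val i))@_(bmnm (enum_val m)).
have : kermx M != 0.
  rewrite kermx_eq0 /row_free neq_ltn (leq_ltn_trans (rank_leq_col _)) //.
  exact: leq_ltn_trans (card_mon2_lt s) sI.
case/rowV0Pn=> v /sub_kermxP vM v0.
exists (fun i => v 0 (enum_rank i)); split.
  case/rV0Pn: v0 => j vj; exists (enum_val j); by rewrite enum_valK.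
apply/mpolyP => m; rewrite raddf_sum mcoeff0 /=.
have [ms|ms] := ltnP (mdeg m) s.
  have := congr1 (fun A : 'rV_ _ => A 0 (enum_rank (BMultinom ms))) vM.
  rewrite !mxE => e; rewrite -[RHS]e (reindex (@enum_val _ (mem I))) /=; last first.
    exists enum_rank => i _; [exact: enum_valK | exact: enum_rankK].
  by apply: eq_bigr => i _; rewrite mcoeffZ !mxE enum_rankK enum_valK.
rewrite big1 // => i _; rewrite mcoeffZ [_@_m]memN_msupp_eq0 ?mulr0 //.
by apply: msize_mdeg_ge; apply: leq_trans ms.
Qed.

(** If [D] bounds the sizes of [p] and [q], the products [p^k q^l c_i] with
    [k, l < m] lie in a space of dimension at most about [(2 D m)^2], whereas
    their number is [m^2] times the number of the [c_i]: for large [m] they are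
    linearly dependent as soon as there are more than [(2 D + 1)^2] of the
    [c_i]. *)
Lemma rank_comp_mpoly (p q : P2) : exists n, rank_le (comp_mpoly [tuple p; q]) n.
Proof.
pose D := maxn (msize p) (msize q).
exists ((2 * D + 1) ^ 2)%N; set n := (_ ^ 2)%N => c.
(* [+2] absorbs the two units lost in [msizeX_leq] for [p ^+ k] and [q ^+ l]. *)
pose E := (\max_i msize (c i))%N; pose m := E.+2.
pose w (i : 'I_n.+1 * ('I_m * 'I_m)) := p ^+ i.2.1 * q ^+ i.2.2 * c i.1.
have ws i : (msize (w i) <= m * (2 * D + 1))%N.
  have cE : (msize (c i.1) <= E)%N by apply: (leq_bigmax i.1).
  have pD : (i.2.1 * msize p <= m * D)%N by rewrite leq_mul ?leq_maxl // ltnW.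
  have qD : (i.2.2 * msize q <= m * D)%N by rewrite leq_mul ?leq_maxr // ltnW.
  have -> : (m * (2 * D + 1) = (m * D + 1) + (m * D + 1) + E)%N by rewrite /m; lia.
  apply: leq_trans (msizeM_leq _ _) (leq_add _ cE).
  apply: leq_trans (msizeM_leq _ _) (leq_add _ _);
    by apply: leq_trans (msizeX_leq _ _) _; rewrite leq_add2r.
have [|a [[[i [k l]] a0] sa]] := bounded_linear_dependence ws.
  rewrite !card_prod !card_ord mulnACA [X in (_ * X < _)%N]mulnn -/n mulnC.
  by rewrite ltn_mul2r muln_gt0 ltnSn.
exists (fun i =>
  \sum_(k : 'I_m * 'I_m) a (i, k) *: 'X_[mon2 (val k.1, val k.2)]); split.
  exists i; apply: contraNneq a0 => /(congr1 (mcoeff (mon2 (val k, val l)))).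
  rewrite raddf_sum mcoeff0 (bigD1 (k, l)) //= mcoeffZ mcoeffX eqxx mulr1.
  rewrite big1 ?addr0 => [->//|[k' l'] kl].
  rewrite mcoeffZ mcoeffX; case: eqP => [/mon2_inj[/val_inj kk /val_inj ll]|_].
    by rewrite kk ll eqxx in kl.
  by rewrite mulr0.
transitivity (\sum_i \sum_k a (i, k) *: w (i, k)); last first.
  by rewrite -[RHS]sa pair_bigA; apply: eq_bigr => -[].
apply: eq_bigr => j _; rewrite rmorph_sum mulr_suml; apply: eq_bigr => h _ /=.
by rewrite comp_mpolyZ comp_mon2 -scalerAl.
Qed.

End Rank.

(** * Factoriality in two variables *)

Lemma mpoly_generated (K : comNzRingType) n (D : {mpoly K[n]} -> Prop) :
    (forall c, D c%:MP) -> (forall i, D 'X_i) ->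
    (forall u v, D u -> D v -> D (u + v)) ->
    (forall u v, D u -> D v -> D (u * v)) ->
  forall u, D u.
Proof.
move=> DC DX DD DM u; rewrite [u]mpolyE; apply: big_ind => [||m _]; [|exact: DD|].
  by rewrite -mpolyC0; apply: DC.
rewrite -mul_mpolyC; apply: (DM) => //; rewrite mpolyXE_id.
apply: big_ind => [||i _]; [by rewrite -mpolyC1; apply: DC|exact: DM|].
by elim: (m i) => [|k IH]; [rewrite expr0 -mpolyC1 | rewrite exprS; apply: DM].
Qed.

Lemma divides_rmorph (A B : idomainType) (f : {rmorphism A -> B}) x y :
  divides x y -> divides (f x) (f y).
Proof. by move=> [z ->]; exists (f z); rewrite rmorphM. Qed.

Section PrimeIso.
Variables (A B : idomainType) (f : {rmorphism A -> B}) (g : {rmorphism B -> A}).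
Hypotheses (fK : cancel f g) (gK : cancel g f).

Lemma prime_iso x : prime_elt x -> prime_elt (f x).
Proof.
move=> [x0 xU xp]; split=> [||y z].
- by apply: contra (x0) => /eqP /(congr1 g); rewrite fK rmorph0 => ->.
- by apply: contra xU => /(rmorph_unit g); rewrite fK.
move=> /(divides_rmorph g); rewrite fK rmorphM => /xp.
by case=> /(divides_rmorph f); rewrite gK; [left|right].
Qed.

Lemma factorial_iso : factorial_domain A -> factorial_domain B.
Proof.
move=> factA y y0; have gy0 : g y != 0.
  by apply: contra y0 => /eqP /(congr1 f); rewrite gK rmorph0 => ->.
have [u [s [uU ps e]]] := factA _ gy0.
exists (f u), [seq f x | x <- s]; split.
- exact: rmorph_unit.
- by move=> _ /mapP[x /ps /prime_iso px ->].
- by rewrite -[LHS]gK e rmorphM rmorph_prod big_map.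
Qed.

End PrimeIso.

Section TwoVariables.
Variable K : comNzRingType.

(** Gauss's lemma and elimination apply to [K[x][y]]. *)
Definition iter_of_mpoly : {rmorphism {mpoly K[2]} -> {poly {poly K}}} :=
  mmap (polyC \o polyC) (fun i => if i == ord0 then 'X%:P else 'X).

Lemma comm_mpoly1 : commr_rmorph (@mpolyC 2 K) ('X_ord0).
Proof. by move=> x; apply: mulrC. Qed.

Definition mpoly_of_poly : {rmorphism {poly K} -> {mpoly K[2]}} :=
  horner_morph comm_mpoly1.

Lemma comm_mpoly2 : commr_rmorph mpoly_of_poly ('X_ord_max).
Proof. by move=> x; apply: mulrC. Qed.

Definition mpoly_of_iter : {rmorphism {poly {poly K}} -> {mpoly K[2]}} :=
  horner_morph comm_mpoly2.

Lemma mpoly_of_iterK : cancel iter_of_mpoly mpoly_of_iter.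
Proof.
apply: mpoly_generated => [c|i|u v|u v].
- by rewrite /= mmapC /= horner_morphC; apply: horner_morphC.
- rewrite /= mmapX mmap1U; have [->|->] := ord2P i.
  + by rewrite /= horner_morphC /= horner_morphX.
  + by rewrite /= horner_morphX.
- by rewrite !rmorphD => -> ->.
- by rewrite !rmorphM => -> ->.
Qed.

Lemma iter_of_mpolyK : cancel mpoly_of_iter iter_of_mpoly.
Proof.
have poly1 (f : {poly K}) : iter_of_mpoly (mpoly_of_poly f) = f%:P.
  elim/poly_ind: f => [|f c IH]; first by rewrite !rmorph0.
  rewrite !rmorphD !rmorphM IH /= horner_morphX horner_morphC /=.
  by rewrite mmapX mmap1U mmapC.
elim/poly_ind => [|f c IH]; first by rewrite !rmorph0.
rewrite !rmorphD !rmorphM IH /= horner_morphX horner_morphC.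
by rewrite -[mmap _ _ _]/(iter_of_mpoly _) poly1 /= mmapX mmap1U.
Qed.

End TwoVariables.

Lemma factorial_mpoly2 (K : fieldType) : factorial_domain {mpoly K[2]}.
Proof.
apply: factorial_iso (@iter_of_mpolyK K) (@mpoly_of_iterK K) _.
exact/factorial_poly/factorial_poly/factorial_field.
Qed.

(** * Prime ideals containing coprime elements *)

Section PrimeIdeals.
Variable B : idomainType.

Definition prime_ideal_pred (q : B -> Prop) :=
  [/\ ~ q 1, forall x y, q x -> q y -> q (x + y), forall x y, q y -> q (x * y) &
      forall x y, q (x * y) -> q x \/ q y].

Lemma prime_ideal_pred_opp q x : prime_ideal_pred q -> q x -> q (- x).
Proof. by case=> _ _ qM _ qx; rewrite -mulN1r; apply: qM. Qed.

Lemma prime_ideal_pred_prod q (I : Type) (r : seq I) (F : I -> B) :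
  prime_ideal_pred q -> q (\prod_(i <- r) F i) -> exists i, q (F i).
Proof.
case=> q1 _ _ qP; elim: r => [|i r IH]; first by rewrite big_nil.
by rewrite big_cons => /qP[|/IH //]; exists i.
Qed.

Lemma prime_ideal_pred_unit q u : prime_ideal_pred q -> u \is a GRing.unit -> ~ q u.
Proof. by case=> q1 _ qM _ uU qu; apply: q1; rewrite -(mulVr uU); apply: qM. Qed.

Lemma prime_ideal_pred_divisible rho : prime_elt rho -> prime_ideal_pred (divides rho).
Proof.
move=> prho; split=> [|x y|x y|x y].
- exact/(prime_ndivides_unit prho)/unitr1.
- exact: dividesD.
- exact: divides_mull.
- exact: prime_mul.
Qed.

End PrimeIdeals.

Lemma prime_ideal_pred_preim (A B : idomainType) (f : {rmorphism A -> B})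
    (q : B -> Prop) :
  prime_ideal_pred q -> prime_ideal_pred (fun x => q (f x)).
Proof.
case=> q1 qD qM qP; split=> [|x y|x y|x y].
- by rewrite rmorph1.
- by rewrite rmorphD; apply: qD.
- by rewrite rmorphM; apply: qM.
- by rewrite rmorphM; apply: qP.
Qed.

Lemma prime_XsubC (K : idomainType) (a : K) : prime_elt ('X - a%:P).
Proof.
have dE f : divides ('X - a%:P) f <-> root f a.
  by split=> [[k ->]|/factor_theorem//]; rewrite rootM root_XsubC eqxx orbT.
split=> [||f g]; first by rewrite polyXsubC_eq0.
  by rewrite poly_unitE size_XsubC.
by rewrite !dE rootM => /orP.
Qed.

(** A nonzero element of least degree divides all the elements of the ideal over
    the field of fractions.  If it were not constant, its primitive part would
    lie in the ideal or its content would be a constant there; in the first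
    case the prime factors of that part divide the whole of [S]. *)
Lemma prime_ideal_meets_constants (K : idomainType) (q S : {poly K} -> Prop) :
    factorial_domain K -> prime_ideal_pred q ->
    coprime_set S -> (forall f, S f -> q f) ->
  exists2 c, c != 0 & q c%:P.
Proof.
move=> factK pq copS Sq; have [q1 qD qM qP] := pq.
have [f0 [Sf0 f0N]] : exists f, S f /\ f != 0.
  apply: contrapT => /forallNP S0; apply: (copS _ (prime_XsubC (0 : K))) => f Sf.
  have [->|f0] := eqVneq f 0; first exact: divides0.
  by case: (S0 f).
have [] := @ex_least (fun n => exists f, [/\ f != 0, q f & size f = n]).
  by exists (size f0), f0; split=> //; apply: Sq.
move=> _ [[g [g0 qg <-]] gmin].
have g_dvd f : q f -> g %| f.
  move=> qf; apply/modp_eq0P/eqP; apply: contraT => rN0.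
  have /gmin : exists f', [/\ f' != 0, q f' & size f' = size (f %% g)].
    exists (f %% g); split=> //.
    have -> : f %% g = (lead_coef g ^+ scalp f g) *: f - (f %/ g) * g.
      by rewrite divp_eq addrC addKr.
    rewrite -mul_polyC; apply: (qD); first exact: qM.
    by apply: (prime_ideal_pred_opp pq); apply: qM.
  by rewrite leqNgt ltn_modpN0.
have [c [h [c0 ph gh]]] := primitive_poly_part factK g0.
move: qg; rewrite gh -mul_polyC => /qP[qc|qh]; first by exists c.
have hN0 : h != 0 by apply: contraNneq g0 => h0; rewrite gh h0 scaler0.
have [hU|hU] := boolP (h \is a GRing.unit).
  by case: (prime_ideal_pred_unit pq hU).
have [pi [ppi dpi]] : exists pi, prime_elt pi /\ divides pi h.
  apply: contrapT => /forallNP np; move/negP: hU; apply.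
  apply: (coprime_set_unit (factorial_poly factK)) => // pi ppi dpi.
  by apply: (np pi).
case: (copS pi ppi) => f /Sq /g_dvd; rewrite gh dvdpZl // => /(primitive_dvdp factK ph).
exact: divides_trans.
Qed.

Section ClosedField.
Variable K : closedFieldType.

Lemma prime_ideal_pred_split (B : idomainType) (iota : {rmorphism {poly K} -> B})
    (q : B -> Prop) f :
    prime_ideal_pred q -> f != 0 -> q (iota f) ->
  exists a, q (iota ('X - a%:P)).
Proof.
move=> pq f0; have [s ->] := closed_field_poly_normal f.
rewrite -mul_polyC rmorphM; case: (pq) => _ _ _ qP /qP[].
  move/(prime_ideal_pred_unit pq); case; apply/rmorph_unit.
  by rewrite poly_unitE coefC eqxx size_polyC lead_coef_eq0 f0 unitfE lead_coef_eq0.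
by rewrite rmorph_prod => /(prime_ideal_pred_prod pq)[a qa]; exists a.
Qed.

(** The ideal contains a nonzero polynomial in [x], hence some [x - a].
    Reducing modulo [x - a] a member of [S] not divisible by it gives a nonzero
    polynomial in [y], hence some [y - b]. *)
Lemma prime_ideal_linear_forms (q S : {poly {poly K}} -> Prop) :
    prime_ideal_pred q -> coprime_set S -> (forall f, S f -> q f) ->
  exists a b, q ('X - a%:P)%:P /\ q ('X - b%:P%:P).
Proof.
move=> pq copS Sq; have [q1 qD qM qP] := pq.
have [c c0 qc] := prime_ideal_meets_constants
  (factorial_poly (@factorial_field K)) pq copS Sq.
have [a qa] := @prime_ideal_pred_split _ polyC q c pq c0 qc.
exists a; suff [h h0 qh] : exists2 h : {poly K}, h != 0 & q (map_poly polyC h).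
  have [b] := @prime_ideal_pred_split _ (map_poly polyC) q h pq h0 qh.
  by rewrite rmorphB /= map_polyX map_polyC /=; exists b.
have [f [Sf ndf]] : exists f, S f /\ ~ divides ('X - a%:P)%:P f.
  apply: contrapT => /forallNP d; apply: (copS _ (prime_polyC (prime_XsubC a))).
  by move=> f Sf; apply: contrapT => nd; apply: (d f).
pose h : {poly K} := map_poly (horner_eval a) f.
have dfh : divides ('X - a%:P)%:P (f - map_poly polyC h).
  apply: polyC_divides => i; rewrite coefB !coef_map /=.
  have /factor_theorem[k ->] : root (f`_i - (horner_eval a f`_i)%:P) a.
    by rewrite rootE !hornerE subrr.
  by exists k.
exists h; first by apply: contra_notN ndf => /eqP h0; move: dfh; rewrite h0 rmorph0 subr0.
rewrite -[map_poly polyC h](subKr f); apply: qD; first exact: Sq.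
by apply: (prime_ideal_pred_opp pq); case: dfh => k ->; apply: qM.
Qed.

End ClosedField.

Lemma mpoly_prime_ideal_linear_forms (K : closedFieldType)
    (q S : {mpoly K[2]} -> Prop) :
    prime_ideal_pred q -> coprime_set S -> (forall f, S f -> q f) ->
  exists a b, q ('X_ord0 - a%:MP) /\ q ('X_ord_max - b%:MP).
Proof.
move=> pq copS Sq.
have [||a [b []]] := @prime_ideal_linear_forms K _ (fun f => S (mpoly_of_iter K f))
    (prime_ideal_pred_preim (mpoly_of_iter K) pq).
- move=> pi ppi dpi.
  apply: (copS _ (prime_iso (@iter_of_mpolyK K) (@mpoly_of_iterK K) ppi)).
  move=> u Su; rewrite -[u]mpoly_of_iterK; apply/divides_rmorph/dpi.
  by rewrite mpoly_of_iterK.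
- by move=> f /Sq.
rewrite !rmorphB /= !horner_morphC !horner_morphX /= horner_morphX !horner_morphC.
by exists a, b.
Qed.

(** * Formally etale morphisms *)

Section DualNumbers.
Variable B : comNzRingType.

(** The ring [B[eps]] with [eps ^ 2 = 0]; the pair [(a, b)] is [a + b eps]. *)
Definition dual : Type := (B * B)%type.

HB.instance Definition _ := GRing.Zmodule.copy dual (B * B)%type.

Definition dual_one : dual := (1, 0).
Definition dual_mul (x y : dual) : dual := (x.1 * y.1, x.1 * y.2 + y.1 * x.2).

Fact dual_mulA : associative dual_mul.
Proof. by move=> [a b] [c d] [e f]; congr (_, _) => /=; ring. Qed.

Fact dual_mulC : commutative dual_mul.
Proof. by move=> [a b] [c d]; congr (_, _) => /=; ring. Qed.

Fact dual_mul1 : left_id dual_one dual_mul.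
Proof. by move=> [a b]; congr (_, _) => /=; ring. Qed.

Fact dual_mulD : left_distributive dual_mul +%R.
Proof. by move=> [a b] [c d] [e f]; congr (_, _) => /=; ring. Qed.

Fact dual_one_neq0 : dual_one != 0.
Proof. by apply/eqP => -[/eqP]; rewrite oner_eq0. Qed.

HB.instance Definition _ := GRing.Zmodule_isComNzRing.Build dual
  dual_mulA dual_mulC dual_mul1 dual_mulD dual_one_neq0.

Definition dual_fst (x : dual) : B := x.1.

Fact dual_fst_additive : zmod_morphism dual_fst.
Proof. by []. Qed.
Fact dual_fst_multiplicative : monoid_morphism dual_fst.
Proof. by []. Qed.
HB.instance Definition _ := GRing.isZmodMorphism.Build dual B dual_fst dual_fst_additive.
HB.instance Definition _ :=
  GRing.isMonoidMorphism.Build dual B dual_fst dual_fst_multiplicative.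

Definition dual_const (b : B) : dual := (b, 0).

Fact dual_const_additive : zmod_morphism dual_const.
Proof. by move=> a b; congr (_, _); rewrite subr0. Qed.
Fact dual_const_multiplicative : monoid_morphism dual_const.
Proof. by split=> // a b; congr (_, _) => /=; rewrite !mulr0 addr0. Qed.
HB.instance Definition _ :=
  GRing.isZmodMorphism.Build B dual dual_const dual_const_additive.
HB.instance Definition _ :=
  GRing.isMonoidMorphism.Build B dual dual_const dual_const_multiplicative.

End DualNumbers.

(** The derivation of [K[x_1, ..., x_n]] into [B] with values [v i] at the
    variables extends along [f] to a derivation of [B], by lifting the identity
    of [B] to the dual numbers.  Subtracting a constant [c] records that [D]
    vanishes on the scalars. *)
Lemma formally_etale_derivation (K : comNzRingType) n (B : comNzRingType)
    (f : {rmorphism {mpoly K[n]} -> B}) (v : 'I_n -> B) : formally_etale f ->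
  exists D : B -> B, (forall x y, D (x * y) = x * D y + y * D x) /\
    forall i c, D (f ('X_i - c%:MP)) = v i.
Proof.
move=> fe.
pose h : 'I_n -> dual B := fun i => (f 'X_i, v i).
pose g : {rmorphism {mpoly K[n]} -> dual B} :=
  mmap (@dual_const B \o (f \o @mpolyC n K)) h.
have gX i : g 'X_i = h i by rewrite /= mmapX mmap1U.
have gC c : g c%:MP = (f c%:MP, 0) by rewrite /= mmapC.
have [|||k [kf kpi _]] := fe _ _ (@dual_fst B) _ _ g idfun.
- by move=> b; exists (b, 0).
- by move=> [a b] [c d]; rewrite /= /dual_fst /= => -> ->; congr (_, _) => /=; ring.
- apply: mpoly_generated => [c|i|x y|x y].
  + by rewrite gC.
  + by rewrite gX.
  + by rewrite !rmorphD => -> ->.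
  + by rewrite !rmorphM => -> ->.
have kE b : k b = (b, (k b).2) by rewrite -{2}[b]kpi; case: (k b).
exists (fun b => (k b).2); split=> [x y|i c].
  by rewrite rmorphM [k x]kE [k y]kE.
by rewrite kf rmorphB gX gC /= /h /= subr0.
Qed.

(** If a prime [rho] divides all the [f s], its inverse image under [f] contains
    some [x - a] and [y - b].  So [f (x - a) = h rho] and [f (y - b) = k rho].
    Extend [d/dx] and [d/dy] to derivations [D1] and [D2] of the target.
    Applying [D1] gives that [h (D1 rho)] is 1 and [k (D1 rho)] is 0 modulo
    [rho], so that [rho] divides [k] and [rho ^ 2] divides [f (y - b)]; then
    [rho] divides [D2 (f (y - b)) = 1]. *)
Lemma formally_etale_coprime (K : closedFieldType)
    (f : {rmorphism {mpoly K[2]} -> {mpoly K[2]}}) (S : {mpoly K[2]} -> Prop) :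
    formally_etale f -> coprime_set S ->
  coprime_set (fun y => exists2 x, S x & y = f x).
Proof.
move=> fe copS rho prho drho.
have [|a [b [[h fa] [k fb]]]] := mpoly_prime_ideal_linear_forms
  (prime_ideal_pred_preim f (prime_ideal_pred_divisible prho)) copS.
  by move=> u Su; apply: drho; exists u.
have [D1 [D1M D1X]] := formally_etale_derivation (fun i => (i == ord0)%:R) fe.
have [D2 [D2M D2X]] := formally_etale_derivation (fun i => (i == ord_max)%:R) fe.
have := D1X ord0 a; have := D1X ord_max b; have := D2X ord_max b.
rewrite !fa !fb !D1M D2M /= => e2 e0 e1.
apply: (prime_ndivides_unit prho (unitr1 _)).
have kE : k = (k * D1 h - h * D1 k) * rho.
  rewrite -{1}[k]mulr1 -[1 in X in X = _]e1.
  transitivity (h * (k * D1 rho + rho * D1 k) + (k * D1 h - h * D1 k) * rho); first by ring.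
  by rewrite e0 mulr0 add0r.
exists ((k * D1 h - h * D1 k) * D2 rho + D2 k).
by rewrite -[LHS]e2 {1}kE; ring.
Qed.

Lemma formally_etale_comp (A B D : comNzRingType) (f : {rmorphism A -> B})
    (g : {rmorphism B -> D}) :
  formally_etale f -> formally_etale g -> formally_etale (g \o f).
Proof.
move=> fe ge C E pi pi_surj pi_sq u h hu.
have [k [kf kpi kU]] := fe _ _ pi pi_surj pi_sq u (h \o g) hu.
have [l [lg lpi lU]] := ge _ _ pi pi_surj pi_sq k h (fun b => esym (kpi b)).
exists l; split=> [a|//|l' l'gf l'pi]; first by rewrite /= lg kf.
apply: lU => // b; apply: (kU (l' \o g)) => [a|c] //=; first exact: l'gf.
Qed.

(** Used to replace a subring by a polynomial ring mapping onto it, or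
    conversely; the factorization of [f] through [e] makes lifting problems for
    [f'] lifting problems for [f]. *)
Lemma formally_etale_surj (A A' B : comNzRingType) (f : {rmorphism A -> B})
    (f' : {rmorphism A' -> B}) (e : {rmorphism A -> A'}) :
    (forall a, f a = f' (e a)) -> (forall a', exists a, e a = a') ->
  formally_etale f -> formally_etale f'.
Proof.
move=> fE e_surj fe C E pi pi_surj pi_sq u h hu.
have [|k [kf kpi kU]] := fe _ _ pi pi_surj pi_sq (u \o e) h.
  by move=> a; rewrite fE hu.
exists k; split=> [a'||l lf lpi] //.
  by have [a <-] := e_surj a'; rewrite -fE kf.
by apply: kU => // a; rewrite fE lf.
Qed.

(** * Subrings generated by two polynomials *)

Lemma mpoly_rmorphism (K S : comNzRingType) n (f : {rmorphism K -> S})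
    (h : 'I_n -> S) :
  exists g : {rmorphism {mpoly K[n]} -> S},
    (forall c, g c%:MP = f c) /\ (forall i, g 'X_i = h i).
Proof.
exists (mmap f h); split=> [c|i]; first exact: mmapC.
by rewrite /= mmapX mmap1U.
Qed.

Section Substitution.
Variables (K : comNzRingType) (p q : {mpoly K[2]}).
Local Notation P2 := {mpoly K[2]}.
Local Notation A := (subring (poly_subring p q)).
Local Notation phi := (comp_mpoly [tuple p; q]).

Lemma comp_mem_poly_subring u : phi u \in poly_subring p q.
Proof. by apply/asboolP; exists u. Qed.

Definition subst (u : P2) : A := Sub (phi u) (comp_mem_poly_subring u).

Lemma incl_subst u : incl _ (subst u) = phi u.
Proof. exact: SubK. Qed.

Fact subst_additive : zmod_morphism subst.
Proof. by move=> u v; apply: val_inj; rewrite rmorphB !SubK rmorphB. Qed.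
Fact subst_multiplicative : monoid_morphism subst.
Proof.
split=> [|u v]; apply: val_inj; first by rewrite rmorph1 SubK rmorph1.
by rewrite rmorphM !SubK rmorphM.
Qed.
HB.instance Definition _ := GRing.isZmodMorphism.Build P2 A subst subst_additive.
HB.instance Definition _ :=
  GRing.isMonoidMorphism.Build P2 A subst subst_multiplicative.

Lemma subst_surj a : exists u, subst u = a.
Proof.
have /asboolP[u ua] := valP a; exists u; apply: val_inj.
by rewrite SubK -ua.
Qed.

Lemma algebraically_independent_inj : algebraically_independent p q -> injective phi.
Proof.
move=> ai u v uv; apply/eqP; rewrite -subr_eq0; apply/eqP/ai.
by rewrite rmorphB /= uv subrr.
Qed.

Lemma subst_inverse : algebraically_independent p q ->
  exists t : {rmorphism A -> P2}, cancel t subst.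
Proof.
move=> ai; have [t tE] := choice subst_surj.
have s_inj : injective subst.
  move=> u v /(congr1 (incl _)); rewrite !incl_subst.
  exact: algebraically_independent_inj.
have t_add : zmod_morphism t.
  by move=> a b; apply: s_inj; rewrite tE rmorphB /= !tE.
have t_mul : monoid_morphism t.
  split=> [|a b]; apply: s_inj; rewrite tE; first by rewrite rmorph1.
  by rewrite rmorphM /= !tE.
pose tA := GRing.isZmodMorphism.Build A P2 t t_add.
pose tM := GRing.isMonoidMorphism.Build A P2 t t_mul.
by exists (HB.pack_for {rmorphism A -> P2} t tA tM).
Qed.

Lemma incl_etale_comp : algebraically_independent p q ->
  formally_etale (incl (poly_subring p q)) -> formally_etale phi.
Proof.
move=> ai fe; have [t tK] := subst_inverse ai.
apply: formally_etale_surj (_ : forall a, incl _ a = phi (t a)) _ fe => [a|u].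
  by rewrite -{1}[a]tK incl_subst.
exists (subst u); apply: (algebraically_independent_inj ai).
by rewrite -!incl_subst tK.
Qed.

Lemma integral_incl_comp b : algebraically_independent p q ->
  integralOver (incl (poly_subring p q)) b <-> integralOver phi b.
Proof.
move=> ai; have [t tK] := subst_inverse ai; split=> -[f fm fb].
  exists (map_poly t f); first exact: monic_map.
  rewrite -map_poly_comp (eq_map_poly (g := incl _)) // => a.
  by rewrite -[RHS]/(incl _ a) -{2}[a]tK incl_subst.
exists (map_poly subst f); first exact: monic_map.
by rewrite -map_poly_comp (eq_map_poly (g := phi)).
Qed.

(** [K[x, y]] is the quotient of [A[X, Y]], where [A = K[p, q]], by the two
    relations [p = p(X, Y)] and [q = q(X, Y)]: modulo these every constant
    [w(p, q)] of [A] equals [w(p(X, Y), q(X, Y))], so every element comes from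
    [K[X, Y]], on which the evaluation is injective. *)
Lemma poly_subring_finitely_presented :
  finitely_presented (incl (poly_subring p q)).
Proof.
have [spec [specC specX]] := mpoly_rmorphism (incl (poly_subring p q))
  (fun i : 'I_2 => 'X_i).
have [gen [genC genX]] := mpoly_rmorphism (@mpolyC 2 A \o (subst \o @mpolyC 2 K))
  (fun i : 'I_2 => 'X_i).
have genK : cancel gen spec.
  apply: mpoly_generated => [c|i|u v|u v].
  - by rewrite genC specC incl_subst comp_mpolyC.
  - by rewrite genX specX.
  - by rewrite !rmorphD => -> ->.
  - by rewrite !rmorphM => -> ->.
pose r (i : 'I_2) := (subst 'X_i)%:MP - gen (phi 'X_i).
pose I u := exists c : 'I_2 -> {mpoly A[2]}, u = \sum_(i < 2) c i * r i.
have ID u v : I u -> I v -> I (u + v).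
  move=> [c ->] [d ->]; exists (fun i => c i + d i).
  by rewrite -big_split; apply: eq_bigr => i _; rewrite mulrDl.
have IM u v : I v -> I (u * v).
  move=> [c ->]; exists (fun i => u * c i).
  by rewrite mulr_sumr; apply: eq_bigr => i _; rewrite mulrA.
have I0 : I 0 by exists (fun=> 0); rewrite big1 // => i _; rewrite mul0r.
have ID' u v u' v' : I (u - u') -> I (v - v') -> I (u + v - (u' + v')).
  by move=> Iu Iv; rewrite opprD addrACA; apply: ID.
have IM' u v u' v' : I (u - u') -> I (v - v') -> I (u * v - u' * v').
  move=> Iu Iv; have -> : u * v - u' * v' = v * (u - u') + u' * (v - v') by ring.
  by apply: ID; apply: IM.
have Ic w : I ((subst w)%:MP - gen (phi w)).
  move: w; apply: mpoly_generated => [c|i|u v|u v].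
  - by rewrite /= comp_mpolyC genC subrr.
  - exists (fun j => (j == i)%:R); rewrite (bigD1 i) // (eqxx i) mul1r.
    by rewrite big1 => [|j /negbTE ->]; [rewrite /= addr0 | rewrite mul0r].
  - by rewrite !rmorphD; apply: ID'.
  - by rewrite !rmorphM; apply: IM'.
have Igen u : I (u - gen (spec u)).
  move: u; apply: mpoly_generated => [a|i|u v|u v].
  - by have [w <-] := subst_surj a; rewrite specC incl_subst.
  - by rewrite specX genX subrr.
  - by rewrite !rmorphD; apply: ID'.
  - by rewrite !rmorphM; apply: IM'.
exists 2%N, spec; split=> [a|b|]; first exact: specC.
  by exists (gen b).
exists 2%N, r => u; split=> [u0|[c ->]].
  by have := Igen u; rewrite u0 rmorph0 subr0.
rewrite rmorph_sum big1 // => i _.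
by rewrite rmorphM rmorphB specC incl_subst genK subrr mulr0.
Qed.

End Substitution.

Section Square.
Variables (K : comNzRingType) (p q : {mpoly K[2]}).
Local Notation phi := (comp_mpoly [tuple p; q]).

Lemma comp_mpoly_square u : u \mPo [tuple phi p; phi q] = phi (phi u).
Proof.
move: u; apply: mpoly_generated => [c|i|u v|u v].
- by rewrite !comp_mpolyC.
- rewrite !comp_mpolyXU; by have [->|->] := ord2P i.
- by rewrite !rmorphD /= => -> ->.
- by rewrite !rmorphM /= => -> ->.
Qed.

(** The inclusion of [K[p, q]] is [phi] up to an isomorphism of the source, so
    that etale extensions can be composed as endomorphisms. *)
Lemma etale_square : etale_polynomial_extension p q ->
  etale_polynomial_extension (phi p) (phi q).
Proof.
move=> [ai [_ fe]]; have fphi := incl_etale_comp ai fe.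
have phi_inj := algebraically_independent_inj ai.
split; first by move=> u; rewrite comp_mpoly_square => /ai/ai.
split; first exact: poly_subring_finitely_presented.
apply: (formally_etale_surj (e := subst (phi p) (phi q)))
  (formally_etale_comp fphi fphi).
  by move=> u; rewrite incl_subst comp_mpoly_square.
exact: subst_surj.
Qed.

End Square.

(** * Conclusion *)

(** Associated primes restated with elements of [B] instead of elements of the
    type attached to [S]. *)
Lemma primary_unique_annihilator (B : comNzRingType) (S : subringClosed B) :
    primary_submodule (subring_as_submod S) ->
  exists P : B -> Prop, forall b, b \notin S ->
    (forall x y, x \in S -> y \in S -> x * y * b \in S -> x * b \in S \/ y * b \in S) ->
  forall x, x \in S -> (P x <-> x * b \in S).
Proof.
move=> [P AssP]; exists (fun x => exists2 s, P s & incl S s = x) => b bS b_prime.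
pose I : set (subring S) := [set s | incl S s * b \in S]%classic.
have inI s : (s \in mem I) = (incl S s * b \in S) by apply/asboolP/idP.
have <- : I = P.
  suff : Ass_quotient (subring_as_submod S) I by rewrite AssP.
  split; last by exists b.
  split.
    split=> [||a s t].
    - by rewrite inI rmorph0 mul0r rpred0.
    - by rewrite inI rmorph1 mul1r.
    - rewrite !inI => sI tI; rewrite rmorphD rmorphM mulrDl -mulrA.
      by rewrite rpredD // rpredM //; apply: (valP a).
  move=> s t; rewrite !inI rmorphM => /(b_prime _ _ (valP s) (valP t)) h.
  by apply/orP.
move=> x xS; split=> [[s sI <-]|xb]; first exact: sI.
by exists (exist _ x xS).
Qed.

Theorem primary_closures_integral (K : closedFieldType) :
  (forall p q : {mpoly K[2]},
     etale_polynomial_extension p q ->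
     ~ (integral_closure (poly_subring p q) =i predT) ->
     primary_submodule
       (subring_as_submod (integral_closure (poly_subring p q)))) ->
  forall p q : {mpoly K[2]},
    etale_polynomial_extension p q ->
    integralRange (incl (poly_subring p q)).
Proof.
move=> prim p q pq b; have [ai [_ fe]] := pq.
pose phi : {rmorphism {mpoly K[2]} -> {mpoly K[2]}} := comp_mpoly [tuple p; q].
pose psi : {rmorphism {mpoly K[2]} -> {mpoly K[2]}} :=
  comp_mpoly [tuple phi p; phi q].
have psiE u : psi u = phi (phi u) by apply: comp_mpoly_square.
have phi_inj : injective phi := algebraically_independent_inj ai.
have pq2 := etale_square pq; have [ai2 _] := pq2.
have intE c : integralOver psi c <->
    c \in integral_closure (poly_subring (phi p) (phi q)).
  apply: iff_trans (rwP (asboolP _)); apply: iff_sym.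
  exact: integral_incl_comp ai2.
have [n rank_n] := rank_comp_mpoly p q.
have [m rank_m] := rank_comp_mpoly (phi p) (phi q).
apply/(integral_incl_comp _ ai).
apply: (integral_of_unique_prime_annihilator psiE phi_inj
  (@factorial_mpoly2 K) rank_n rank_m).
  by move=> S; apply/formally_etale_coprime/incl_etale_comp.
move=> notall; have [|P PE] := primary_unique_annihilator (prim _ _ pq2 _).
  by move=> all; apply: notall => c; apply/intE; rewrite all.
exists P => c [cI cprime] x /intE xI.
apply: iff_trans (PE c _ _ x xI) (iff_sym (intE _)); first by apply/negP => /intE.
move=> y z /intE yI /intE zI /intE yz.
by have [/intE|/intE] := cprime y z yI zI yz; [left|right].
Qed.

Theorem theorem3p12 (R : realType) :
  (forall p q : {mpoly R[i][2]},
     etale_polynomial_extension p q ->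
     ~ (integral_closure (poly_subring p q) =i predT) ->
     primary_submodule
       (subring_as_submod (integral_closure (poly_subring p q)))) ->
  forall p q : {mpoly R[i][2]},
    etale_polynomial_extension p q ->
    integralRange (incl (poly_subring p q)).
Proof. exact: primary_closures_integral. Qed.
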